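(* Let $\ell$ be an odd prime. The number of non-conjugate subgroups of $\mathrm{GL}_2(\mathbf{Z}/\ell\mathbf{Z})$ (that is, the number of conjugacy classes of subgroups) that lie in a split Cartan group is \[\frac{\alpha(\ell-1)+\beta(\ell-1)}{2}.\]
   Context: Split Cartan groups are the conjugates in $\mathrm{GL}_2(\mathbf{Z}/\ell\mathbf{Z})$ of the group of invertible diagonal matrices. For a positive integer $n$, $\alpha(n):=\sum_{a,b\mid n}\gcd(a,b)$, where $a$ and $b$ independently range over the positive divisors of $n$. For $n=\prod_p p^{e_p}$, $\beta(n):=\beta_2(n)\prod_{p\ne2}(e_p+1)^2$, where $\beta_2(n):=2(e_2^2-e_2)+3$ if $n$ is even and $\beta_2(n):=1$ if $n$ is odd. *)

(* Defs.v *)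
From HB Require Import structures.
From mathcomp Require Import all_boot all_order all_fingroup all_algebra.

Set Implicit Arguments.
Unset Strict Implicit.
Unset Printing Implicit Defensive.

Import GroupScope.

(* For l prime, 'F_l is the ring Z/lZ and {'GL_2['F_l]} is the type of elements
   of GL_2(Z/lZ). *)

Definition diagGL (l : nat) : {set {'GL_2['F_l]}} :=
  [set g : {'GL_2['F_l]} | is_diag_mx (GLval g)].

Lemma diagGL_group_set (l : nat) : group_set (diagGL l).
Proof.
apply/group_setP; split=> [|g h]; rewrite !inE.
  exact: (@scalar_mx_is_diag _ _ 1%R).
move=> /diag_mxP[d dE] /diag_mxP[e eE].
by rewrite GL_ME dE eE -[(_ * _)%R]/(_ *m _)%R mulmx_diag diag_mx_is_diag.
Qed.

Canonical diagGL_group (l : nat) : {group {'GL_2['F_l]}} :=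
  Group (diagGL_group_set l).

Definition split_Cartan (l : nat) (C : {group {'GL_2['F_l]}}) : bool :=
  [exists g : {'GL_2['F_l]}, C :==: diagGL l :^ g].

Definition in_split_Cartan (l : nat) (H : {group {'GL_2['F_l]}}) : bool :=
  [exists C : {group {'GL_2['F_l]}}, split_Cartan C && (H \subset C)].

Definition split_Cartan_classes (l : nat) : {set {set {set {'GL_2['F_l]}}}} :=
  [set (H : {set {'GL_2['F_l]}}) :^: 'GL_2(l)
     | H : {group {'GL_2['F_l]}} & in_split_Cartan H].

Definition alpha (n : nat) : nat :=
  (\sum_(a <- divisors n) \sum_(b <- divisors n) gcdn a b)%N.

(* The subtraction is truncated, which is harmless since e <= e ^ 2. *)
Definition beta2 (n : nat) : nat :=
  (let e := logn 2 n in
   if odd n then 1 else 2 * (e ^ 2 - e) + 3)%N.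

Definition beta (n : nat) : nat :=
  (beta2 n * \prod_(p <- primes n | p != 2) (logn p n + 1) ^ 2)%N.

(* Main.v *)
Require Import Defs.
From mathcomp Require Import all_boot all_order all_fingroup all_algebra.
From mathcomp Require Import cyclic zify.

Set Implicit Arguments.
Unset Strict Implicit.
Unset Printing Implicit Defensive.

(** Let [T] be the group of invertible diagonal matrices and [n = l - 1]. Every
    subgroup of a split Cartan group is conjugate to a subgroup of [T], so the
    task is to count the subgroups of [T] up to conjugacy in GL_2.

    If a subgroup [H] of [T] contains a non-scalar [h], then a matrix [g] for
    which [h ^ g] is diagonal must carry the two eigenlines of [h] to the
    coordinate axes, hence is diagonal or antidiagonal; if [H] consists of
    scalars, every [g] fixes it. So the conjugates of [H] inside [T] are [H]
    and [H :^ w], where [w] exchanges the coordinates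
    ([conjs_diagGL_in_diagGL]). The classes are therefore the orbits of an
    involution on the set of subgroups of [T], and twice their number is the
    number of subgroups plus the number of subgroups fixed by [w]
    ([card_involution_orbits]).

    Since the units of F_l form a cyclic group of order [n], [T] is a product of
    two cyclic groups of order [n], generated by elements [x] and [y] that [w]
    exchanges. A subgroup of [T] has a unique Hermite normal form
    [<x ^ a y ^ t, y ^ b>] with [a] and [b] dividing [n], [t < b] and [b]
    dividing [t * (n / a)]. For fixed [a] and [b] there are [gcd(b, n / a)]
    values of [t], so there are [alpha n] subgroups ([card_subgroups]). The
    subgroup is fixed by [w] exactly when [b = a * c] and [t = a * s] with
    [s ^ 2 = 1] modulo [c]. With [r(c)] the number of square roots of 1 modulo
    [c], the number of fixed subgroups is thus the sum of [r(c)] over the pairs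
    [a], [c] such that [a * c] divides [n] ([card_swap_fixed]).

    That sum is a multiplicative function of [n], because [r] is one by the
    Chinese remainder theorem and summing over divisors preserves
    multiplicativity. For odd [p], [r(p ^ k) = 2] when [k > 0], and
    [r(2 ^ k)] is 1, 1, 2, 4, 4, ... for [k = 0, 1, 2, 3, 4, ...]; so its values
    at prime powers are the factors of [beta n] ([divisor_sum_sqrt1_beta]). *)

(** * Multiplicative functions and sums over divisors *)

Lemma gcdnM_coprime d m n :
  coprime m n -> d %| m * n -> gcdn d m * gcdn d n = d.
Proof.
move=> co_mn dvd_d; apply/eqP; rewrite eqn_dvd; apply/andP; split.
  rewrite Gauss_dvd ?dvdn_gcdl //.
  exact: coprime_dvdl (dvdn_gcdr _ _) (coprime_dvdr (dvdn_gcdr _ _) co_mn).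
rewrite muln_gcdl !muln_gcdr !dvdn_gcd dvd_d.
by rewrite dvdn_mulr // dvdn_mulr // dvdn_mull.
Qed.

(** For coprime [m] and [n], the factorization of a divisor of [m * n] into a
    divisor of [m] and one of [n] is unique: the factors are its gcds with [m]
    and with [n]. *)
Lemma perm_divisorsM m n : 0 < m -> 0 < n -> coprime m n ->
  perm_eq (divisors (m * n)) [seq d * e | d <- divisors m, e <- divisors n].
Proof.
move=> m_gt0 n_gt0 co_mn; apply: uniq_perm; first exact: divisors_uniq.
  apply: allpairs_uniq; rewrite ?divisors_uniq // => -[a b] [c d].
  case/allpairsP=> -[a' b'] /= [a_m b_n [-> ->]].
  case/allpairsP=> -[c' d'] /= [c_m d_n [-> ->]].
  have gcdm x y : x \in divisors m -> y \in divisors n -> gcdn (x * y) m = x.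
    rewrite -!dvdn_divisors // => x_m y_n.
    rewrite gcdnC Gauss_gcdl ?(coprime_dvdr y_n) //; exact/gcdn_idPr.
  have gcdN x y : x \in divisors m -> y \in divisors n -> gcdn (x * y) n = y.
    rewrite -!dvdn_divisors // => x_m y_n.
    rewrite gcdnC Gauss_gcdr 1?coprime_sym ?(coprime_dvdl x_m) //.
    exact/gcdn_idPr.
  move=> eq_mul; congr (_, _).
    by rewrite -(gcdm a' b') // eq_mul gcdm.
  by rewrite -(gcdN a' b') // eq_mul gcdN.
move=> d; rewrite -dvdn_divisors ?muln_gt0 ?m_gt0 //; apply/idP/allpairsP.
  move=> dvd_d; exists (gcdn d m, gcdn d n) => /=.
  by rewrite -!dvdn_divisors ?dvdn_gcdr // gcdnM_coprime.
by case=> -[a b] /= []; rewrite -!dvdn_divisors // => ? ? ->; apply: dvdn_mul.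
Qed.

Definition multiplicative (f : nat -> nat) : Prop :=
  f 1 = 1 /\
  (forall m n, 0 < m -> 0 < n -> coprime m n -> f (m * n) = f m * f n).

Definition divisor_sum (f : nat -> nat) (n : nat) : nat :=
  \sum_(d <- divisors n) f d.

Lemma multiplicative_divisor_sum f :
  multiplicative f -> multiplicative (divisor_sum f).
Proof.
case=> f1 fM; split=> [|m n m_gt0 n_gt0 co_mn]; rewrite /divisor_sum.
  by rewrite (_ : divisors 1 = [:: 1]) // big_seq1.
rewrite (perm_big _ (perm_divisorsM m_gt0 n_gt0 co_mn)) big_allpairs_dep.
rewrite big_distrl big_seq [RHS]big_seq /=; apply: eq_bigr => d.
rewrite -dvdn_divisors // => d_m; rewrite big_distrr.
rewrite big_seq [RHS]big_seq; apply: eq_bigr => e.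
rewrite -dvdn_divisors // => e_n; apply: fM.
- exact: dvdn_gt0 d_m.
- exact: dvdn_gt0 e_n.
- exact: coprime_dvdl d_m (coprime_dvdr e_n co_mn).
Qed.

Lemma multiplicative_prod_primes f n : multiplicative f -> 0 < n ->
  f n = \prod_(p <- primes n) f (p ^ logn p n).
Proof.
case=> f1 fM n_gt0; rewrite [in LHS](prod_prime_decomp n_gt0) prime_decompE.
rewrite big_map /=.
suff gen s : uniq s -> all prime s ->
    f (\prod_(p <- s) p ^ logn p n) = \prod_(p <- s) f (p ^ logn p n).
  apply: gen; first exact: primes_uniq.
  by apply/allP=> p; rewrite mem_primes => /andP[].
elim: s => [|p s IHs] /=; first by rewrite !big_nil.
case/andP=> p_s uniq_s /andP[p_pr s_pr]; rewrite !big_cons fM ?IHs //.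
  by rewrite big_seq prodn_cond_gt0 // => q /(allP s_pr) /prime_gt0 q_gt0;
     rewrite expn_gt0 q_gt0.
rewrite big_seq; apply: (big_rec (coprime (p ^ logn p n))) => [|q x q_s co_x].
  exact: coprimen1.
rewrite coprimeMr co_x andbT coprimeXl ?coprimeXr // prime_coprime //.
rewrite (dvdn_prime2 p_pr (allP s_pr q q_s)).
by apply: contraNneq p_s => ->.
Qed.

Lemma divisor_sum_pfactor f p e : prime p ->
  divisor_sum f (p ^ e) = \sum_(k < e.+1) f (p ^ k).
Proof.
move=> p_pr; rewrite /divisor_sum -(big_mkord xpredT (fun k => f (p ^ k))).
rewrite -[RHS](big_map (expn p) xpredT).
apply: perm_big; apply: uniq_perm; first exact: divisors_uniq.
  rewrite map_inj_uniq ?iota_uniq // => i j eq_ij.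
  by apply/eqP; rewrite -(eqn_exp2l i j (prime_gt1 p_pr)); apply/eqP.
move=> d; rewrite -dvdn_divisors ?expn_gt0 ?prime_gt0 //.
apply/(dvdn_pfactor _ _ p_pr)/mapP => -[k].
  by move=> k_e ->; exists k; rewrite ?mem_index_iota.
by rewrite mem_index_iota => k_e ->; exists k.
Qed.

Lemma divisor_sum_div f n : 0 < n ->
  divisor_sum (fun d => f (n %/ d)) n = divisor_sum f n.
Proof.
move=> n_gt0; rewrite /divisor_sum -(big_map (divn n) xpredT f).
have divnK' d : d %| n -> n %/ (n %/ d) = d.
  by move=> d_n; rewrite divnA // mulKn.
apply/perm_big/uniq_perm; rewrite ?divisors_uniq //.
  rewrite map_inj_in_uniq ?divisors_uniq // => d e.
  rewrite -!dvdn_divisors // => d_n e_n eq_de.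
  by rewrite -[d]divnK' // eq_de divnK'.
move=> d; rewrite -dvdn_divisors //; apply/mapP/idP => [[e e_n ->] | d_n].
  by rewrite dvdn_div // dvdn_divisors.
by exists (n %/ d); rewrite ?divnK' // -dvdn_divisors // dvdn_div.
Qed.

Lemma sum_ord_divisors (F : nat -> nat) n N : 0 < n < N ->
  \sum_(d < N | d %| n) F d = divisor_sum F n.
Proof.
case/andP=> n_gt0 lt_nN.
rewrite -(big_mkord (fun d => d %| n) F) -big_filter.
apply/perm_big/uniq_perm.
- by rewrite filter_uniq ?iota_uniq.
- exact: divisors_uniq.
move=> d.
rewrite mem_filter mem_index_iota -dvdn_divisors //.
by apply: andb_idr => /(dvdn_leq n_gt0) /leq_ltn_trans->.
Qed.

(** * Square roots of 1 modulo an integer *)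

Definition num_sqrt1 (c : nat) : nat :=
  \sum_(s < c) (s ^ 2 == 1 %[mod c]).

(** The Chinese remainder bijection on residues is compatible with squaring. *)
Lemma num_sqrt1M m n : 0 < m -> 0 < n -> coprime m n ->
  num_sqrt1 (m * n) = num_sqrt1 m * num_sqrt1 n.
Proof.
move=> m_gt0 n_gt0 co_mn; rewrite /num_sqrt1.
have lt_mod c (c_gt0 : 0 < c) (s : nat) : s %% c < c by rewrite ltn_mod.
pose crt (u : 'I_m * 'I_n) : 'I_(m * n) :=
  Ordinal (lt_mod _ (etrans (muln_gt0 m n) (introT andP (conj m_gt0 n_gt0)))
             (chinese m n u.1 u.2)).
pose res (s : 'I_(m * n)) : 'I_m * 'I_n :=
  (Ordinal (lt_mod m m_gt0 s), Ordinal (lt_mod n n_gt0 s)).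
rewrite (reindex crt) /=; last first.
  exists res => [[u v] | s] _ /=.
    congr (_, _); apply: val_inj => /=.
      rewrite modn_dvdm ?dvdn_mulr // chinese_modl //; exact: modn_small.
    rewrite modn_dvdm ?dvdn_mull // chinese_modr //; exact: modn_small.
  by apply: val_inj; rewrite /= -chinese_mod // modn_small.
rewrite big_distrlr (pair_big xpredT xpredT) /=.
apply: eq_bigr => -[u v] _ /=.
rewrite chinese_remainder // -mulnb; congr (nat_of_bool _ * nat_of_bool _).
  rewrite -modnXm [in LHS]modn_dvdm ?dvdn_mulr // chinese_modl //.
  by rewrite modnXm.
rewrite -modnXm [in LHS]modn_dvdm ?dvdn_mull // chinese_modr //.
by rewrite modnXm.
Qed.

Lemma multiplicative_num_sqrt1 : multiplicative num_sqrt1.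
Proof. by split; [rewrite /num_sqrt1 big_ord1 | exact: num_sqrt1M]. Qed.

Lemma sqr_eq1_mod c s : 0 < s ->
  (s ^ 2 == 1 %[mod c]) = (c %| (s - 1) * (s + 1)).
Proof. by move=> s_gt0; rewrite eqn_mod_dvd ?expn_gt0 ?s_gt0 // -subn_sqr. Qed.

Lemma num_sqrt1_seq c (t : seq nat) : uniq t ->
  (forall s, (s < c) && (s ^ 2 == 1 %[mod c]) = (s \in t)) ->
  num_sqrt1 c = size t.
Proof.
move=> uniq_t tP; rewrite /num_sqrt1.
rewrite -(big_mkord xpredT (fun s => nat_of_bool (s ^ 2 == 1 %[mod c]))).
rewrite -[LHS]big_mkcondr sum1_count -size_filter.
apply/perm_size/uniq_perm; rewrite ?filter_uniq ?iota_uniq // => s.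
by rewrite mem_filter mem_index_iota andbC tP.
Qed.

(** An odd prime [p] cannot divide both [s - 1] and [s + 1], so [p ^ k] divides
    one of them; the only roots are 1 and -1. *)
Lemma num_sqrt1_odd p k : prime p -> p != 2 -> 0 < k -> num_sqrt1 (p ^ k) = 2.
Proof.
move=> p_pr p_n2 k_gt0.
have p_gt2 : 2 < p by have := prime_gt1 p_pr; lia.
have c_gt2 : 2 < p ^ k.
  apply: leq_trans p_gt2 _; rewrite -{1}(expn1 p) leq_pexp2l //.
  exact: prime_gt0.
rewrite (@num_sqrt1_seq _ [:: 1; p ^ k - 1]) //= ?inE; first lia.
move=> s; rewrite !inE; case: (posnP s) => [-> | s_gt0].
  rewrite exp0n // mod0n modn_small; lia.
rewrite sqr_eq1_mod //; apply/andP/orP => [[s_lt dvd_c] | [] /eqP->].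
- case p_s: (p %| s - 1).
    left; move: dvd_c; rewrite Gauss_dvdl.
      case: (posnP (s - 1)) => [? _|]; first by lia.
      by move=> s1_gt0 /(dvdn_leq s1_gt0); lia.
    rewrite coprimeXl // prime_coprime //; apply/negP => p_s1.
    have two : (s + 1) - (s - 1) = 2 by lia.
    have : p %| 2 by rewrite -two dvdn_sub.
    by move/(@dvdn_leq _ 2 isT); lia.
  right; move: dvd_c; rewrite Gauss_dvdr; last first.
    by rewrite coprimeXl // prime_coprime // p_s.
  by move/dvdn_leq; lia.
- by rewrite subnn mul0n dvdn0; split=> //; lia.
- by rewrite subnK ?dvdn_mull //; [split=> //; lia | lia].
Qed.

(** A root is odd, [s = 2 * u + 1], and [s ^ 2 - 1 = 4 * u * (u + 1)]. As one of
    [u] and [u + 1] is odd, the other is divisible by [N = 2 ^ (k + 1)]; with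
    [u < 2 * N] this leaves four possibilities. *)
Lemma num_sqrt1_2 k : num_sqrt1 (2 ^ k.+3) = 4.
Proof.
set N := 2 ^ k.+1; have N_gt1 : 1 < N by rewrite /N -{1}(expn0 2) ltn_exp2l.
have cE : 2 ^ k.+3 = 4 * N by rewrite /N !expnS; lia.
have N_even : ~~ odd N by rewrite /N oddX.
have co_N u : odd u -> coprime N u.
  by move=> u_odd; rewrite coprimeXl // coprime2n.
have sqrtP u : (4 * N %| 2 * u * (2 * u + 2)) = (N %| u * (u + 1)).
  by rewrite (_ : 2 * u * (2 * u + 2) = 4 * (u * (u + 1))) ?dvdn_pmul2l //; lia.
pose roots := [:: 1; 2 * N - 1; 2 * N + 1; 4 * N - 1].
rewrite cE (@num_sqrt1_seq _ roots) //= ?inE; first lia.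
move=> s; rewrite !inE; case: (boolP (odd s)) => [s_odd | s_even]; last first.
  rewrite [RHS](_ : _ = false); last by apply/negbTE; lia.
  apply/negbTE/negP => /andP[_ /eqP /(congr1 (modn^~ 2))].
  rewrite !modn_dvdm ?dvdn_mulr // !modn2 oddX (negbTE s_even) //.
have [u sE] : exists u, s = 2 * u + 1 by exists s./2; lia.
rewrite sqr_eq1_mod; last lia.
rewrite sE addnK -addnA sqrtP.
apply/andP/idP => [[s_lt dvd_N] | u_root].
  case: (boolP (odd u)) => u_odd.
    move: dvd_N; rewrite Gauss_dvdr ?co_N // => /dvdnP[q qE].
    have : q < 3 by nia.
    by case: q qE => [|[|[|q]]] //; lia.
  move: dvd_N; rewrite Gauss_dvdl ?co_N ?addn1 //= => /dvdnP[q qE].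
  have : q < 2 by nia.
  by case: q qE => [|[|q]] //; lia.
split; first lia.
have [u0 | uN | uN | uN] : [\/ u = 0, u + 1 = N, u = N | u + 1 = 2 * N].
  by case/or4P: u_root => /eqP sN;
    [constructor 1 | constructor 2 | constructor 3 | constructor 4]; lia.
- by rewrite u0 mul0n dvdn0.
- by rewrite uN dvdn_mull.
- by rewrite uN dvdn_mulr.
- by rewrite uN dvdn_mull // dvdn_mull.
Qed.

(** The inner sums are [1 + 2 * k], and the first odd numbers add up to a
    square. *)
Lemma sum_num_sqrt1_odd p e : prime p -> p != 2 ->
  divisor_sum (divisor_sum num_sqrt1) (p ^ e) = (e + 1) ^ 2.
Proof.
move=> p_pr p_n2; rewrite divisor_sum_pfactor //.
have inner k : divisor_sum num_sqrt1 (p ^ k) = 2 * k + 1.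
  rewrite divisor_sum_pfactor // big_ord_recl /=.
  rewrite (proj1 multiplicative_num_sqrt1) (eq_bigr (fun=> 2)) => [|i _].
    rewrite sum_nat_const card_ord; lia.
  exact: num_sqrt1_odd.
rewrite (eq_bigr (fun k : 'I_e.+1 => 2 * k + 1)) => [|k _]; last exact: inner.
elim: e => [|e IHe]; first by rewrite big_ord1.
rewrite big_ord_recr IHe /=; lia.
Qed.

(** The inner sums are 1, 2, and then [4 * (k - 1)] for [k >= 2], whence
    [3 + 2 * e * (e - 1)]. *)
Lemma sum_num_sqrt1_2 e : 0 < e ->
  divisor_sum (divisor_sum num_sqrt1) (2 ^ e) = 2 * (e ^ 2 - e) + 3.
Proof.
have sqrt1_1 : num_sqrt1 (2 ^ 0) = 1 by rewrite /num_sqrt1 big_ord1.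
have sqrt1_2 : num_sqrt1 (2 ^ 1) = 1.
  by rewrite /num_sqrt1 !big_ord_recl big_ord0.
have sqrt1_4 : num_sqrt1 (2 ^ 2) = 2.
  by rewrite /num_sqrt1 !big_ord_recl big_ord0.
have inner k : divisor_sum num_sqrt1 (2 ^ k.+2) = 4 * k.+1.
  rewrite divisor_sum_pfactor //.
  elim: k => [|k IHk].
    by rewrite !big_ord_recl big_ord0 /= sqrt1_1 sqrt1_2 sqrt1_4.
  by rewrite big_ord_recr IHk /= num_sqrt1_2; lia.
rewrite divisor_sum_pfactor //; case: e => // e _.
elim: e => [|e IHe].
  rewrite !big_ord_recl big_ord0 !divisor_sum_pfactor //.
  by rewrite !big_ord_recl !big_ord0 /= sqrt1_1 sqrt1_2.
rewrite big_ord_recr IHe /= inner; nia.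
Qed.

Lemma divisor_sum_sqrt1_beta n : 0 < n ->
  divisor_sum (divisor_sum num_sqrt1) n = beta n.
Proof.
move=> n_gt0.
rewrite (multiplicative_prod_primes _ n_gt0); last first.
  by do 2!apply: multiplicative_divisor_sum; exact: multiplicative_num_sqrt1.
have odd_part : \prod_(p <- primes n | p != 2)
    divisor_sum (divisor_sum num_sqrt1) (p ^ logn p n) =
    \prod_(p <- primes n | p != 2) (logn p n + 1) ^ 2.
  rewrite big_seq_cond [RHS]big_seq_cond; apply: eq_bigr => p /andP[].
  by rewrite mem_primes => /andP[p_pr _] p_n2; exact: sum_num_sqrt1_odd.
rewrite /beta /beta2; case: ifPn => [n_odd | n_even].
  rewrite mul1n -odd_part [RHS]big_seq_cond [LHS]big_seq_cond.
  apply: eq_bigl => p; case: eqVneq => [-> | _]; last by rewrite andbT.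
  by rewrite mem_primes dvdn2 n_odd !andbF.
have two_n : 2 \in primes n by rewrite mem_primes n_gt0 dvdn2.
rewrite (bigD1_seq 2) ?primes_uniq //= odd_part sum_num_sqrt1_2 //.
by rewrite logn_gt0.
Qed.

(** * The divisor sum behind alpha *)

(** Dividing [b] and [m] by their gcd [g] turns the condition on [t] into
    [b / g] divides [t], which [g] of the residues modulo [b] satisfy. *)
Lemma sum_dvdn_mul b m : 0 < b -> \sum_(t < b) (b %| t * m) = gcdn b m.
Proof.
move=> b_gt0; set g := gcdn b m.
have g_gt0 : 0 < g by rewrite gcdn_gt0 b_gt0.
have [d bE] : exists d, b = d * g.
  by exists (b %/ g); rewrite divnK // dvdn_gcdl.
have [q mE] : exists q, m = q * g.
  by exists (m %/ g); rewrite divnK // dvdn_gcdr.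
have co_dq : coprime d q.
  by rewrite /coprime -(eqn_pmul2r g_gt0) muln_gcdl -bE -mE mul1n.
have dvdE t : (b %| t * m) = (d %| t).
  by rewrite bE mE mulnA dvdn_pmul2r // Gauss_dvdl.
under eq_bigr do rewrite dvdE.
have d_gt0 : 0 < d by move: b_gt0; rewrite bE muln_gt0 => /andP[].
rewrite -(big_mkord xpredT (fun t => nat_of_bool (d %| t))).
have <- : b %/ d = g by rewrite bE mulKn.
have d_b : d %| b by rewrite bE dvdn_mulr.
rewrite divn_count_dvd -[b]prednK // big_nat_recl // dvdn0 addnC.
by rewrite big_add1 [RHS]big_nat_recr //= prednK // d_b.
Qed.

(** The involution [a -> n / a] on the divisors of [n] yields the definition of
    [alpha]. *)
Lemma sum_gcdn_alpha n : 0 < n ->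
  divisor_sum (fun a => divisor_sum (fun b => gcdn b (n %/ a)) n) n = alpha n.
Proof.
move=> n_gt0.
rewrite (divisor_sum_div (fun a => divisor_sum (fun b => gcdn b a) n)) //.
by apply: eq_bigr => a _; apply: eq_bigr => b _; rewrite gcdnC.
Qed.

(** * Subgroups of a product of two cyclic groups of the same order *)

Lemma card_triples (P : nat -> nat -> nat -> bool) N :
  #|[set u : 'I_N * 'I_N * 'I_N | P u.1.1 u.1.2 u.2]|
  = (\sum_(a < N) \sum_(b < N) \sum_(t < N) P a b t)%N.
Proof.
rewrite -sum1dep_card [LHS]big_mkcond pair_big pair_big /=.
by apply: eq_bigr => -[[a b] t] _ /=; case: (P _ _ _).
Qed.

Lemma sum_ord_ltn c N (P : pred nat) : (c <= N)%N ->
  (\sum_(s < N) ((s < c) && P s) = \sum_(s < c) P s)%N.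
Proof.
move=> le_cN.
rewrite [RHS](big_ord_widen N (fun s => nat_of_bool (P s)) le_cN).
rewrite [RHS]big_mkcond.
by apply: eq_bigr => s _; case: ifP.
Qed.

Section RankTwo.

Import GroupScope.

Variables (gT : finGroupType) (A : {group gT}) (x y : gT) (n : nat).
Hypothesis n_gt0 : (0 < n)%N.
Hypothesis xyC : commute x y.
Hypothesis genA : forall g, reflect (exists i j, g = x ^+ i * y ^+ j) (g \in A).
Hypothesis eq_xy : forall i j i' j',
  (x ^+ i * y ^+ j == x ^+ i' * y ^+ j')
  = (i == i' %[mod n]) && (j == j' %[mod n]).

(** [eq_xy] makes [xy] induce an isomorphism from (Z/n)^2 to [A]; keeping
    natural numbers as coordinates allows divisibility arguments on them. *)
Definition xy i j := x ^+ i * y ^+ j.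

Lemma xyM i j i' j' : xy i j * xy i' j' = xy (i + i') (j + j').
Proof.
rewrite /xy !expgD -!mulgA; congr (_ * _); rewrite !mulgA; congr (_ * _).
exact/commuteX2/commute_sym.
Qed.

Lemma xyX i j k : xy i j ^+ k = xy (k * i) (k * j).
Proof.
by elim: k => [|k IHk]; [rewrite /xy mulg1 | rewrite expgS IHk xyM -!mulSn].
Qed.

Lemma xy_mod i j i' j' :
  i = i' %[mod n] -> j = j' %[mod n] -> xy i j = xy i' j'.
Proof. by move=> eq_i eq_j; apply/eqP; rewrite eq_xy eq_i eq_j !eqxx. Qed.

Lemma xy_inA i j : xy i j \in A. Proof. by apply/genA; exists i, j. Qed.

Lemma eq_subgroup (H K : {group gT}) : H \subset A -> K \subset A ->
  (forall i j, (xy i j \in H) = (xy i j \in K)) -> H = K.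
Proof.
move=> sHA sKA eqHK; apply/val_inj/setP => g /=.
have [/genA[i [j ->]]|gA] := boolP (g \in A); first exact: eqHK.
by rewrite (contraNF (subsetP sHA g)) ?(contraNF (subsetP sKA g)).
Qed.

(** The rows of the Hermite normal form are the generators [(a, t)] and
    [(0, b)]. *)
Definition hnf a b t : {group gT} := (<[xy a t]> <*> <[xy 0 b]>)%G.

Lemma hnf_sub a b t : hnf a b t \subset A.
Proof. by rewrite join_subG !cycle_subG !xy_inA. Qed.

Lemma mem_hnfP a b t g :
  reflect (exists k m, g = xy (k * a) (k * t + m * b)) (g \in hnf a b t).
Proof.
have cxy : <[xy a t]> \subset 'C(<[xy 0 b]>).
  rewrite cycle_subG; apply/centP => _ /cycleP[m ->].
  by rewrite /commute xyX !xyM (addnC a) (addnC t).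
rewrite /= cent_joinEl //; apply: (iffP mulsgP).
  case=> _ _ /cycleP[k ->] /cycleP[m ->] ->; exists k, m.
  by rewrite !xyX xyM muln0 addn0.
case=> k [m ->]; exists (xy a t ^+ k) (xy 0 b ^+ m); rewrite ?mem_cycle //.
by rewrite !xyX xyM muln0 addn0.
Qed.

(** The last condition says that the subgroup contains no [xy 0 j] besides those
    with [b %| j]: the power [n %/ a] of the first generator is
    [xy 0 (t * (n %/ a))]. *)
Definition hnf_index a b t : bool :=
  [&& a %| n, b %| n, t < b & b %| t * (n %/ a)]%N.

(** Natural subtraction truncates, so the exponent [j - k] is represented by
    [j + n * k - k], to which it is congruent modulo [n]. *)
Lemma le_shift j k : (k <= j + n * k)%N.
Proof. exact: leq_trans (leq_pmull _ n_gt0) (leq_addl _ _). Qed.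

(** Exponents are only defined modulo [n], but [i] modulo [a] and [j] modulo [b]
    make sense since [a] and [b] divide [n], and [t * (i %/ a)] modulo [b] does
    too since [b] divides [t * (n %/ a)]. *)
Lemma mem_hnf a b t i j : hnf_index a b t ->
  (xy i j \in hnf a b t) = (a %| i) && (j == t * (i %/ a) %[mod b]).
Proof.
case/and4P=> a_n b_n lt_tb b_tna.
have a_gt0 : (0 < a)%N := dvdn_gt0 n_gt0 a_n.
apply/mem_hnfP/idP => [[k [m /eqP]] | /andP[/dvdnP[k ->]]].
  rewrite eq_xy => /andP[/eqP eq_i /eqP eq_j].
  have a_i : a %| i.
    by rewrite /dvdn -(modn_dvdm i a_n) eq_i modn_dvdm // modnMl.
  rewrite a_i /= -(modn_dvdm j b_n) eq_j modn_dvdm // addnC modnMDl.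
  case/dvdnP: a_i eq_i => k' ->; rewrite mulnK // -[in X in X -> _](divnK a_n).
  rewrite -!muln_modl // => /eqP; rewrite eqn_pmul2r // => eq_k.
  have : (t * (k' %% (n %/ a)) = t * (k %% (n %/ a)))%N by rewrite (eqP eq_k).
  rewrite !muln_modr => /(congr1 (modn^~ b)).
  by rewrite !modn_dvdm // (mulnC k) => ->.
rewrite mulnK // => eq_j.
have : (b %| j + n * (t * k) - t * k)%N.
  rewrite -eqn_mod_dvd ?le_shift //.
  by rewrite -modnDmr (eqP (dvdn_mulr _ b_n)) addn0 (eqP eq_j).
case/dvdnP=> m mE; exists k, m; apply: xy_mod => //.
have -> : (k * t + m * b = j + n * (t * k))%N.
  by rewrite -mE (mulnC k) subnKC ?le_shift.
by rewrite addnC (mulnC n) modnMDl.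
Qed.

(** [a] generates the first projection of the subgroup, [b] generates its
    intersection with the second factor, and [t] is determined modulo [b] as the
    second coordinate of the elements above [a]. *)
Lemma hnf_inj a b t a' b' t' : hnf_index a b t -> hnf_index a' b' t' ->
  hnf a b t = hnf a' b' t' -> [/\ a = a', b = b' & t = t'].
Proof.
move=> ix ix' eq_hnf; case/and4P: (ix) => a_n _ lt_tb _.
case/and4P: (ix') => a_n' _ lt_tb' _.
have a_gt0 := dvdn_gt0 n_gt0 a_n; have a_gt0' := dvdn_gt0 n_gt0 a_n'.
have memE i j : (a %| i) && (j == t * (i %/ a) %[mod b])
    = (a' %| i) && (j == t' * (i %/ a') %[mod b']).
  by rewrite -!mem_hnf // eq_hnf.
have eq_a : a = a'.
  apply/eqP; rewrite eqn_dvd.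
  have := memE a' t'; rewrite divnn a_gt0' muln1 dvdnn eqxx => /andP[-> _].
  by have := memE a t; rewrite divnn a_gt0 muln1 dvdnn eqxx => /esym/andP[-> _].
have eq_b : b = b'.
  apply/eqP; rewrite eqn_dvd.
  have := memE 0 b'; have := memE 0 b.
  by rewrite !div0n !muln0 !dvdn0 !mod0n !modnn !eqxx /dvdn /= => <- ->.
split=> //; have := memE a t.
rewrite -eq_a -eq_b !dvdnn divnn a_gt0 !muln1 eqxx /= => /esym/eqP.
by rewrite !modn_small // eq_b.
Qed.

(** [a] and [b] are chosen as the least positive first coordinate and the least
    positive second coordinate above 0; Euclidean division by them describes the
    whole subgroup. *)
Lemma hnf_surj (H : {group gT}) : H \subset A ->
  exists a b t, hnf_index a b t /\ H = hnf a b t.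
Proof.
move=> sHA.
have xy1 k l : xy (k * n) (l * n) = 1.
  by rewrite (@xy_mod _ _ 0 0) ?modnMl ?mod0n // /xy mulg1.
have x_n : xy n 0 \in H by have := group1 H; rewrite -(xy1 1 0)%N mul1n.
have y_n : xy 0 n \in H by have := group1 H; rewrite -(xy1 0 1)%N mul1n.
have exa : exists a, (0 < a)%N && [exists j : 'I_n, xy a j \in H].
  by exists n; rewrite n_gt0; apply/existsP; exists (Ordinal n_gt0).
have exb : exists b, (0 < b)%N && (xy 0 b \in H).
  by exists n; rewrite n_gt0.
case: (ex_minnP exa) => a /andP[a_gt0 /existsP[[t0 _] /= at0_H]] min_a.
case: (ex_minnP exb) => b /andP[b_gt0 b_H] min_b.
have b_dvd j : (xy 0 j \in H) = (b %| j).
  have -> : xy 0 j = xy 0 b ^+ (j %/ b) * xy 0 (j %% b).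
    by rewrite xyX xyM muln0 -divn_eq.
  rewrite groupMl ?groupX // /dvdn; have := ltn_pmod j b_gt0.
  case: (posnP (j %% b)) => [-> _ | r_gt0 lt_rb].
    by rewrite /xy mulg1 group1.
  apply/negbTE/negP => r_H.
  by have := min_b (j %% b)%N; rewrite r_gt0 r_H leqNgt lt_rb => /(_ isT).
have b_n : b %| n by rewrite -b_dvd.
have a_dvd i j : xy i j \in H -> a %| i.
  pose r := (j + n * (t0 * (i %/ a)) - t0 * (i %/ a))%N.
  have -> : xy i j = xy a t0 ^+ (i %/ a) * xy (i %% a) (r %% n).
    rewrite xyX xyM -divn_eq; apply: xy_mod => //.
    rewrite modnDmr (mulnC (i %/ a)) subnKC ?le_shift //.
    by rewrite addnC (mulnC n) modnMDl.
  rewrite groupMl ?groupX // /dvdn => r_H; have := ltn_pmod i a_gt0.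
  case: posnP => // r_gt0 lt_ra.
  have /min_a : (0 < i %% a)%N && [exists k : 'I_n, xy (i %% a) k \in H].
    by rewrite r_gt0; apply/existsP; exists (Ordinal (ltn_pmod r n_gt0)).
  by rewrite leqNgt lt_ra.
have H_mem k j : (xy (k * a) j \in H) = (j == t0 * k %[mod b]).
  have -> : xy (k * a) j = xy a t0 ^+ k * xy 0 (j + n * (t0 * k) - t0 * k).
    rewrite xyX xyM addn0; apply: xy_mod => //.
    rewrite (mulnC k) subnKC ?le_shift //.
    by rewrite addnC (mulnC n) modnMDl.
  rewrite groupMl ?groupX // b_dvd -eqn_mod_dvd ?le_shift //.
  by rewrite -modnDmr (eqP (dvdn_mulr _ b_n)) addn0 eq_sym.
have a_n : a %| n by exact: a_dvd x_n.
have ix : hnf_index a b (t0 %% b).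
  rewrite /hnf_index a_n b_n ltn_pmod //= /dvdn modnMml.
  rewrite -[in X in _ == X](mod0n b) eq_sym -H_mem divnK //.
exists a, b, (t0 %% b); split=> //; apply: eq_subgroup => // [|i j].
  exact: hnf_sub.
rewrite mem_hnf // modnMml; have [/dvdnP[k ->] | a'i] := boolP (a %| i).
  by rewrite H_mem mulnK.
by apply: contraNF a'i; exact: a_dvd.
Qed.

Lemma card_subgroups : #|[set H : {group gT} | H \subset A]| = alpha n.
Proof.
rewrite -sum_gcdn_alpha //.
pose I := 'I_n.+1.
pose P a b t := hnf_index a b t.
pose F (u : I * I * I) := hnf u.1.1 u.1.2 u.2.
have -> : [set H : {group gT} | H \subset A]
    = F @: [set u : I * I * I | P u.1.1 u.1.2 u.2].
  apply/setP=> H; rewrite inE; apply/idP/imsetP => [sHA | [u _ ->]]; last first.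
    exact: hnf_sub.
  have [a [b [t [ix ->]]]] := hnf_surj sHA; case/and4P: (ix) => a_n b_n lt_tb _.
  have lt_a : (a < n.+1)%N by rewrite ltnS dvdn_leq.
  have lt_b : (b < n.+1)%N by rewrite ltnS dvdn_leq.
  exists (Ordinal lt_a, Ordinal lt_b, Ordinal (ltn_trans lt_tb lt_b)) => //.
  by rewrite inE.
rewrite card_in_imset => [|[[a b] t] [[a' b'] t']]; last first.
  rewrite !inE /= => ix ix' /(hnf_inj ix ix').
  by case=> /val_inj-> /val_inj-> /val_inj->.
rewrite card_triples -(@sum_ord_divisors _ n n.+1) ?n_gt0 //= [RHS]big_mkcond.
apply: eq_bigr => -[a /= lt_a] _; case: ifP => a_n; last first.
  by rewrite big1 // => b _; rewrite big1 // => t _; rewrite /P /hnf_index a_n.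
rewrite -(@sum_ord_divisors _ n n.+1) ?n_gt0 //= [RHS]big_mkcond.
apply: eq_bigr => -[b /= lt_b] _; case: ifP => b_n; last first.
  by rewrite big1 // => t _; rewrite /P /hnf_index b_n andbF.
rewrite -sum_dvdn_mul; last exact: dvdn_gt0 b_n.
rewrite -(@sum_ord_ltn b n.+1 (fun t => b %| t * (n %/ a))%N) 1?ltnW //.
by apply: eq_bigr => t _; rewrite /P /hnf_index a_n b_n.
Qed.

Variable w : gT.
Hypotheses (xw : x ^ w = y) (yw : y ^ w = x).

Lemma xyJ i j : xy i j ^ w = xy j i.
Proof. by rewrite /xy conjMg !conjXg xw yw; apply/commuteX2/commute_sym. Qed.

Lemma swap_fixedP (H : {group gT}) : H \subset A ->
  reflect (forall i j, xy i j \in H -> xy j i \in H) (H :^ w == H).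
Proof.
move=> sHA; rewrite eqEcard cardJg leqnn andbT.
apply: (iffP subsetP) => [fixH i j | fixH _ /imsetP[g gH ->]].
  by rewrite -(xyJ i j) -(memJ_conjg H w) => /fixH.
have /genA[i [j gE]] := subsetP sHA g gH.
by move: gH; rewrite gE [x ^+ i * _]/(xy i j) xyJ; apply: fixH.
Qed.

(** The parameters of the subgroups fixed by the exchange of [x] and [y]: the
    normal form is then [a] times that of a lattice [<(1, s), (0, c)>], and
    exchanging coordinates in [(1, s)] yields [(s, 1)], which must be
    [s * (1, s)] modulo [c]. *)
Definition sym_index a c s : bool :=
  [&& a * c %| n, s < c & s ^ 2 == 1 %[mod c]]%N.

Lemma sym_hnf_index a c s : sym_index a c s -> hnf_index a (a * c) (a * s).
Proof.
case/and3P=> ac_n lt_sc _.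
have := dvdn_gt0 n_gt0 ac_n; rewrite muln_gt0 => /andP[a_gt0 c_gt0].
have a_n : a %| n by apply: dvdn_trans ac_n; exact: dvdn_mulr.
rewrite /hnf_index a_n ac_n ltn_pmul2l // lt_sc -mulnA dvdn_pmul2l //=.
by rewrite dvdn_mull // dvdn_divRL // mulnC.
Qed.

Lemma sym_hnf_fixed a c s :
  sym_index a c s -> hnf a (a * c) (a * s) :^ w == hnf a (a * c) (a * s).
Proof.
move=> sym; have ix := sym_hnf_index sym; case/and3P: sym => ac_n _ /eqP s2.
have := dvdn_gt0 n_gt0 ac_n; rewrite muln_gt0 => /andP[a_gt0 c_gt0].
apply/swap_fixedP=> [|i j]; first exact: hnf_sub.
rewrite !mem_hnf // => /andP[/dvdnP[i' ->] /eqP].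
rewrite mulnK // -mulnA => eq_j.
have /dvdnP[j' jE] : a %| j.
  rewrite /dvdn -(@modn_dvdm (a * c)) ?dvdn_mulr // eq_j.
  by rewrite modn_dvdm ?dvdn_mulr // modnMr.
move: eq_j; rewrite jE mulnK // dvdn_mull // (mulnC j') (mulnC i') -mulnA.
rewrite -!muln_modr => /eqP; rewrite eqn_pmul2l // => /eqP eq_j.
rewrite /= eqn_pmul2l // -modnMmr eq_j modnMmr mulnA mulnn.
by rewrite -modnMml s2 modnMml mul1n.
Qed.

(** The images [(t, a)] and [(b, 0)] of the two generators lie in the subgroup,
    so [a] divides [t] and [b], and the congruence for [(t, a)] says
    [(t / a) ^ 2 = 1] modulo [b / a]. *)
Lemma hnf_fixed_sym a b t : hnf_index a b t -> hnf a b t :^ w == hnf a b t ->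
  exists c s, [/\ b = a * c, t = a * s & sym_index a c s]%N.
Proof.
move=> ix /swap_fixedP-/(_ (hnf_sub a b t)) fixH.
case/and4P: (ix) => a_n b_n lt_tb _; have a_gt0 := dvdn_gt0 n_gt0 a_n.
have := fixH a t; rewrite !mem_hnf // dvdnn divnn a_gt0 muln1 eqxx.
case/(_ isT)/andP=> /dvdnP[s tE]; rewrite tE mulnK // => t2.
have := fixH 0 b; rewrite !mem_hnf // dvdn0 div0n muln0 modnn mod0n eqxx.
case/(_ isT)/andP=> /dvdnP[c bE] _; exists c, s.
rewrite bE in b_n lt_tb t2; rewrite tE ltn_pmul2r // in lt_tb.
split; rewrite 1?mulnC //; rewrite /sym_index (mulnC a) b_n lt_tb /=.
move: t2; rewrite mulnAC -{1}(mul1n a) -!muln_modl // eqn_pmul2r //.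
by rewrite mulnn eq_sym.
Qed.

Lemma card_swap_fixed :
  #|[set H : {group gT} | (H \subset A) && (H :^ w == H)]| = beta n.
Proof.
rewrite -divisor_sum_sqrt1_beta // -divisor_sum_div //.
pose I := 'I_n.+1.
pose F (u : I * I * I) := hnf u.1.1 (u.1.1 * u.1.2) (u.1.1 * u.2).
have -> : [set H : {group gT} | (H \subset A) && (H :^ w == H)]
    = F @: [set u : I * I * I | sym_index u.1.1 u.1.2 u.2].
  apply/setP=> H; rewrite inE; apply/andP/imsetP => [[sHA] | [u]]; last first.
    by rewrite inE => sym ->; rewrite hnf_sub sym_hnf_fixed.
  have [a [b [t [ix ->]]]] := hnf_surj sHA.
  case/(hnf_fixed_sym ix) => c [s [-> -> sym]].
  case/and3P: (sym) => ac_n lt_sc _.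
  have lt_a : (a < n.+1)%N.
    by rewrite ltnS dvdn_leq // (dvdn_trans _ ac_n) // dvdn_mulr.
  have lt_c : (c < n.+1)%N.
    by rewrite ltnS dvdn_leq // (dvdn_trans _ ac_n) // dvdn_mull.
  exists (Ordinal lt_a, Ordinal lt_c, Ordinal (ltn_trans lt_sc lt_c)) => //.
  by rewrite inE.
rewrite card_in_imset => [|[[a c] s] [[a' c'] s']]; last first.
  rewrite !inE /= => sym sym'; have ix := sym_hnf_index sym.
  case/(hnf_inj ix (sym_hnf_index sym')) => /val_inj eq_a.
  have a_gt0 : (0 < a)%N by case/and4P: ix => /(dvdn_gt0 n_gt0).
  rewrite -eq_a => /eqP; rewrite eqn_pmul2l // => /eqP/val_inj->.
  by move=> /eqP; rewrite eqn_pmul2l // => /eqP/val_inj->.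
rewrite card_triples -(@sum_ord_divisors _ n n.+1) ?n_gt0 //= [RHS]big_mkcond.
apply: eq_bigr => -[a /= lt_a] _; case: ifP => a_n; last first.
  rewrite big1 // => c _; rewrite big1 // => s _; rewrite /sym_index.
  case: (boolP (_ %| n)) => // /(dvdn_trans (dvdn_mulr c (dvdnn a))).
  by rewrite a_n.
have a_gt0 := dvdn_gt0 n_gt0 a_n.
have na_bd : (0 < n %/ a < n.+1)%N.
  by rewrite divn_gt0 // (dvdn_leq n_gt0 a_n) ltnS leq_div.
rewrite -(sum_ord_divisors num_sqrt1 na_bd).
rewrite [RHS]big_mkcond; apply: eq_bigr => -[c /= lt_c] _.
rewrite dvdn_divRL // mulnC; case: ifP => ac_n; last first.
  by rewrite big1 // => s _; rewrite /sym_index ac_n.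
rewrite /num_sqrt1.
rewrite -(@sum_ord_ltn c n.+1 (fun s => s ^ 2 == 1 %[mod c])%N) 1?ltnW //.
by apply: eq_bigr => s _; rewrite /sym_index ac_n.
Qed.

End RankTwo.

(** * Orbits of an involution *)

(** Each fiber of [f] on [X] is [{h, s h}]. It has either two elements, none of
    them fixed, or a single one, which is fixed; so every fiber contributes 2 to
    the left-hand side. *)
Lemma card_involution_orbits (T U : finType) (X : {set T}) (s : T -> T)
    (f : T -> U) :
  {in X, forall h, s h \in X} ->
  {in X &, forall h k, (f k == f h) = (k == h) || (k == s h)} ->
  #|X| + #|[set h in X | s h == h]| = 2 * #|f @: X|.
Proof.
move=> sX fP.
have -> : #|X| + #|[set h in X | s h == h]| = \sum_(h in X) (1 + (s h == h)).
  rewrite big_split /= sum1_card; congr (_ + _).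
  by rewrite -sum1dep_card [LHS]big_mkcondr; apply: eq_bigr => h _; case: ifP.
rewrite (partition_big_imset f) mulnC -sum_nat_const; apply: eq_bigr => u.
case/imsetP=> h hX ->.
have sfh : f (s h) = f h by apply/eqP; rewrite fP ?sX // eqxx orbT.
have ssh : (s (s h) == s h) = (s h == h).
  have := fP _ _ (sX h hX) hX; rewrite sfh eqxx => /esym/orP[/eqP hE | /eqP hE].
    by rewrite -hE -hE eqxx.
  by rewrite -hE eq_sym.
transitivity (\sum_(k in h |: [set s h]) (1 + (s k == k))).
  apply: eq_bigl => k; rewrite !inE; apply/andP/orP => [[kX] | [] /eqP->].
  - by rewrite fP // => /orP.
  - by rewrite hX eqxx.
  - by rewrite sX // sfh eqxx.
have [sh | sh] := eqVneq (s h) h; first by rewrite sh setUid big_set1 sh eqxx.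
by rewrite big_setU1 /= ?big_set1 ?ssh ?(negbTE sh) // inE eq_sym.
Qed.

(** * Conjugacy classes of subgroups *)

Section ConjugacyClasses.

Import GroupScope.

Variable gT : finGroupType.
Implicit Types (D H K : {group gT}).

Lemma conj_class_eqP H K :
  reflect (exists g, K = (H :^ g)%G) (K :^: [set: gT] == H :^: [set: gT]).
Proof.
apply: (iffP eqP) => [eqKH | [g ->]]; last first.
  by rewrite conjugates_conj lcoset_id // inE.
have : (K : {set gT}) \in K :^: [set: gT].
  by apply/imsetP; exists 1; rewrite ?inE ?conjsg1.
by rewrite eqKH => /imsetP[g _ KE]; exists g; apply: val_inj.
Qed.

Lemma conj_classes_sub D :
  [set (H : {set gT}) :^: [set: gT]
     | H : {group gT} in [set H : {group gT} | [exists g, H \subset D :^ g]]]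
  = [set (H : {set gT}) :^: [set: gT]
     | H : {group gT} in [set H : {group gT} | H \subset D]].
Proof.
apply/setP=> c; apply/imsetP/imsetP => -[H]; rewrite inE => HP ->.
  case/existsP: HP => g sHDg; exists (H :^ g^-1)%G.
    by rewrite inE /= sub_conjgV.
  by apply/eqP/conj_class_eqP; exists g; apply: val_inj; rewrite /= conjsgKV.
exists H => //; rewrite inE; apply/existsP; exists 1.
by rewrite conjsg1.
Qed.

End ConjugacyClasses.

(** * Diagonal matrices in GL_2 of a finite field *)

Section GL2.

Import GroupScope GRing.Theory.
Local Open Scope ring_scope.

Variable F : finFieldType.
Implicit Types (g h k : {'GL_2[F]}) (u v : {unit F}).

Lemma ord2P (P : 'I_2 -> Prop) : P 0 -> P 1 -> forall i, P i.
Proof.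
move=> P0 P1 [[|[|i]] lt_i] //.
  by rewrite (_ : Ordinal _ = 0) //; apply: val_inj.
by rewrite (_ : Ordinal _ = 1) //; apply: val_inj.
Qed.

Lemma mulmx2E (A B : 'M[F]_2) i j :
  (A *m B) i j = A i 0 * B 0 j + A i 1 * B 1 j.
Proof.
rewrite mxE (bigD1 0) //= (bigD1 1) //= big1 ?addr0 // => k.
by elim/ord2P: k.
Qed.

Lemma eq_mx2 (A B : 'M[F]_2) : A 0 0 = B 0 0 -> A 0 1 = B 0 1 ->
  A 1 0 = B 1 0 -> A 1 1 = B 1 1 -> A = B.
Proof. by move=> *; apply/matrixP; do 2!elim/ord2P. Qed.

Lemma diag_mx2E (A : 'M[F]_2) : is_diag_mx A = (A 0 1 == 0) && (A 1 0 == 0).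
Proof.
apply/is_diag_mxP/andP => [dA | [/eqP A01 /eqP A10]].
  by split; apply/eqP/dA.
by do 2!elim/ord2P.
Qed.

Lemma GL2_row_neq0 g i : GLval g i 0 = 0 -> GLval g i 1 != 0.
Proof.
move=> gi0; apply: contraTneq (oner_neq0 F) => gi1.
have := congr1 (fun h => GLval h i i) (mulgV g).
rewrite GL_MxE mulmx2E gi0 gi1 !mul0r addr0 /= mxE eqxx => /esym/eqP.
by rewrite negbK.
Qed.

Definition diag_mx2 u v : 'M[F]_2 :=
  \matrix_(i, j) if i != j then 0 else if i == 0 then val u else val v.

Lemma mul_diag_mx2 u v u' v' :
  diag_mx2 u v *m diag_mx2 u' v' = diag_mx2 (u * u') (v * v').
Proof.
by apply: eq_mx2; rewrite mulmx2E !mxE /= ?(mulr0, mul0r, addr0, add0r).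
Qed.

Lemma diag_mx2_1 : diag_mx2 1 1 = 1%:M.
Proof. by apply: eq_mx2; rewrite !mxE. Qed.

Lemma diag_mx2_unit u v : diag_mx2 u v \is a GRing.unit.
Proof.
by have [] := @mulmx1_unit _ _ (diag_mx2 u v) (diag_mx2 u^-1 v^-1);
  rewrite // mul_diag_mx2 !mulgV diag_mx2_1.
Qed.

Definition diagGL2 u v : {'GL_2[F]} := FinRing.unit _ (diag_mx2_unit u v).

Lemma diagGL2M u v u' v' :
  (diagGL2 u v * diagGL2 u' v' = diagGL2 (u * u') (v * v'))%g.
Proof. by apply: val_inj; rewrite /= -mul_diag_mx2. Qed.

Lemma diagGL2X u v n : (diagGL2 u v ^+ n = diagGL2 (u ^+ n) (v ^+ n))%g.
Proof.
elim: n => [|n IHn]; first by apply: val_inj; rewrite /= diag_mx2_1.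
by rewrite !expgS IHn diagGL2M.
Qed.

Lemma diagGL2_inj u v u' v' : diagGL2 u v = diagGL2 u' v' -> u = u' /\ v = v'.
Proof.
move/(congr1 val)/matrixP => eq_d; have := eq_d 0 0; have := eq_d 1 1.
by rewrite !mxE /= => /val_inj-> /val_inj->.
Qed.

Lemma diagGL2_surj g : is_diag_mx (GLval g) -> exists u v, g = diagGL2 u v.
Proof.
rewrite diag_mx2E => /andP[/eqP g01 /eqP g10].
have g00 : GLval g 0 0 \is a GRing.unit.
  rewrite unitfE; apply: contraTneq (eqxx (0 : F)) => /GL2_row_neq0.
  by rewrite g01 eqxx.
have g11 : GLval g 1 1 \is a GRing.unit.
  by rewrite unitfE; have := GL2_row_neq0 g10.
exists (FinRing.unit F g00), (FinRing.unit F g11).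
by apply: val_inj; apply: eq_mx2; rewrite /= !mxE.
Qed.

Definition swap_mx : 'M[F]_2 := \matrix_(i, j) (i != j)%:R.

Lemma swap_mxK : swap_mx *m swap_mx = 1%:M.
Proof.
by apply: eq_mx2; rewrite mulmx2E !mxE /= ?(mulr0, mul0r, addr0, add0r, mulr1).
Qed.

Lemma swap_mx_unit : swap_mx \is a GRing.unit.
Proof. by have [] := mulmx1_unit swap_mxK. Qed.

Definition swapGL2 : {'GL_2[F]} := FinRing.unit _ swap_mx_unit.

Lemma swapGL2K : (swapGL2 * swapGL2 = 1)%g.
Proof. by apply: val_inj; exact: swap_mxK. Qed.

Lemma diagGL2_swap u v : (diagGL2 u v ^ swapGL2 = diagGL2 v u)%g.
Proof.
apply: (mulgI swapGL2); rewrite -conjgC; apply: val_inj.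
change (diag_mx2 u v *m swap_mx = swap_mx *m diag_mx2 v u).
by apply: eq_mx2;
  rewrite !mulmx2E !mxE /= ?(mulr0, mul0r, addr0, add0r, mulr1, mul1r).
Qed.

(** Comparing entries in [h g = g (h ^ g)], a nonzero entry [g i j] forces the
    [i]-th eigenvalue of [h] to be the [j]-th one of [h ^ g]. As the eigenvalues
    of [h] differ, each column of the invertible matrix [g] has exactly one
    nonzero entry: [g] is diagonal or antidiagonal. *)
Lemma GL2_conj_diag g h : is_diag_mx (GLval h) -> is_diag_mx (GLval (h ^ g)) ->
  GLval h 0 0 != GLval h 1 1 ->
  is_diag_mx (GLval g) || is_diag_mx (GLval (g * swapGL2)%g).
Proof.
have: GLval h *m GLval g = GLval g *m GLval (h ^ g)%g.
  by rewrite -!GL_MxE -conjgC.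
move: (h ^ g)%g => k eq_gk; rewrite !diag_mx2E.
move=> /andP[/eqP h01 /eqP h10] /andP[/eqP k01 /eqP k10] neq_h.
have gkE i j : GLval g i j * GLval h i i = GLval g i j * GLval k j j.
  move/matrixP/(_ i j): eq_gk; rewrite !mulmx2E; move: i j.
  by do 2!elim/ord2P;
    rewrite ?(h01, h10, k01, k10) ?(mulr0, mul0r, addr0, add0r) mulrC.
have {}gkE i j : GLval g i j != 0 -> GLval h i i = GLval k j j.
  by move=> nz; apply: (mulfI nz).
rewrite GL_MxE !mulmx2E !mxE /= !(mulr0, mulr1, addr0, add0r).
have [g00 | g00] := eqVneq (GLval g 0 0) 0.
  apply/orP; right; apply/andP; split; first exact/eqP.
  apply: contraNT neq_h => /gkE->.
  by rewrite (gkE 0 1) ?GL2_row_neq0.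
apply/orP; left; apply/andP.
have g10 : GLval g 1 0 == 0.
  by apply: contraNT neq_h => /gkE->; rewrite (gkE 0 0).
split=> //; apply: contraNT neq_h => /gkE->.
by rewrite (gkE 1 1) ?GL2_row_neq0 // (eqP g10).
Qed.

End GL2.

(** * Conjugacy classes of subgroups of split Cartan groups *)

Section SplitCartan.

Import GroupScope GRing.Theory.
Local Open Scope ring_scope.

Variable l : nat.
Hypothesis l_prime : prime l.

Let gT : finGroupType := {'GL_2['F_l]}.
Let w : gT := swapGL2 'F_l.

Lemma mem_diagGL (g : gT) : (g \in diagGL l) = is_diag_mx (GLval g).
Proof. by rewrite inE. Qed.

Lemma abelian_diagGL : abelian (diagGL l).
Proof.
apply/centsP=> g; rewrite inE => /diagGL2_surj[u [v ->]] h.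
rewrite inE => /diagGL2_surj[u' [v' ->]].
by rewrite /commute !diagGL2M; congr diagGL2; apply: val_inj; exact: mulrC.
Qed.

Lemma conjs_diagGL (H : {group gT}) g : H \subset diagGL l -> g \in diagGL l ->
  (H :^ g)%g = H.
Proof.
move=> sHD gD; apply: normP; apply: (subsetP (cent_sub H)).
exact: (subsetP (centS sHD)) (subsetP abelian_diagGL g gD).
Qed.

Lemma swap_diagGL g : g \in diagGL l -> (g ^ w \in diagGL l)%g.
Proof.
rewrite !inE => /diagGL2_surj[u [v ->]].
by rewrite diagGL2_swap diag_mx2E /= !mxE eqxx.
Qed.

(** [GL2_conj_diag] applies as soon as [H] contains a non-scalar matrix. A
    diagonal [g] centralizes [H], and an antidiagonal one is the product of a
    diagonal matrix and [w]. *)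
Lemma conjs_diagGL_in_diagGL (H K : {group gT}) :
  H \subset diagGL l -> K \subset diagGL l ->
  reflect (exists g, K = (H :^ g)%G) ((K == H) || (K == (H :^ w)%G)).
Proof.
move=> sHD sKD; apply: (iffP orP) => [[] /eqP-> | [g KE]].
- by exists 1%g; apply: val_inj; rewrite /= conjsg1.
- by exists w.
rewrite {K}KE in sKD *; have K_conj h : h \in H -> is_diag_mx (GLval (h ^ g)).
  by rewrite -(memJ_conjg H g) -mem_diagGL; exact: (subsetP sKD).
have [scalH | nscal] := boolP [forall h in H, GLval h 0 0 == GLval h 1 1].
  left; apply/eqP/val_inj/normP/(subsetP (cent_sub H))/centP => h hH.
  have /eqP h01 := forall_inP scalH h hH.
  have := subsetP sHD h hH; rewrite inE diag_mx2E => /andP[/eqP d01 /eqP d10].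
  apply: val_inj; change (GLval g *m GLval h = GLval h *m GLval g).
  have -> : GLval h = (GLval h 0 0)%:M by apply: eq_mx2; rewrite !mxE.
  exact: scalar_mxC.
case/forall_inPn: nscal => h hH neq_h.
have hD : is_diag_mx (GLval h) by rewrite -mem_diagGL (subsetP sHD).
case/orP: (GL2_conj_diag hD (K_conj h hH) neq_h) => [gD | gwD].
  by left; apply/eqP/val_inj/conjs_diagGL; rewrite // inE.
right; apply/eqP/val_inj; pose d : gT := (g * w)%g.
have gE : g = (d * w)%g by rewrite /d -mulgA swapGL2K mulg1.
by rewrite /= gE conjsgM (@conjs_diagGL H d) // inE.
Qed.

Lemma in_split_CartanE (H : {group gT}) :
  in_split_Cartan H = [exists g : gT, H \subset diagGL l :^ g]%g.
Proof.
apply/existsP/existsP => [[C /andP[/existsP[g /eqP CE] sHC]] | [g sHDg]].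
  by exists g; rewrite -CE.
exists (diagGL_group l :^ g)%G; rewrite sHDg andbT.
by apply/existsP; exists g.
Qed.

Lemma split_Cartan_classesE : split_Cartan_classes l
  = [set (H : {set gT}) :^: [set: gT] | H : {group gT} in
      [set H : {group gT} | H \subset diagGL l]]%g.
Proof.
rewrite -[RHS](conj_classes_sub (diagGL_group l)).
apply/setP=> c; apply/imsetP/imsetP => -[H HP ->]; exists H => //;
  by rewrite !inE in_split_CartanE in HP *.
Qed.

Lemma cyclic_unit_Fp : exists u : {unit 'F_l},
  #[u]%g = (l - 1)%N /\ forall v, exists i, v = (u ^+ i)%g.
Proof.
have /cyclicP[u uE] := field_unit_group_cyclic [set: {unit 'F_l}]%G.
exists u; split=> [|v].
  by rewrite /order -uE card_finField_unit card_Fp // subn1.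
by have /cycleP : v \in <[u]>%g by rewrite -uE inE.
Qed.

Lemma card_classes_double :
  (2 * #|split_Cartan_classes l| = alpha (l - 1) + beta (l - 1))%N.
Proof.
have [u [ord_u gen_u]] := cyclic_unit_Fp.
pose x : gT := diagGL2 u 1; pose y : gT := diagGL2 1 u.
have xyE i j : (x ^+ i * y ^+ j = diagGL2 (u ^+ i) (u ^+ j))%g.
  by rewrite !diagGL2X diagGL2M !expg1n mulg1 mul1g.
have n_gt0 : (0 < l - 1)%N by rewrite subn_gt0 prime_gt1.
have xyC : commute x y by rewrite /commute !diagGL2M !mulg1 !mul1g.
have genA g :
    reflect (exists i j, g = x ^+ i * y ^+ j)%g (g \in diagGL_group l).
  apply: (iffP idP) => [|[i [j ->]]].
    rewrite inE => /diagGL2_surj[a [b ->]].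
    have [[i ->] [j ->]] := (gen_u a, gen_u b).
    by exists i, j; rewrite xyE.
  by rewrite xyE inE diag_mx2E /= !mxE eqxx.
have eq_xy i j i' j' : (x ^+ i * y ^+ j == x ^+ i' * y ^+ j')%g
    = (i == i' %[mod l - 1]) && (j == j' %[mod l - 1]).
  rewrite !xyE -ord_u -!eq_expg_mod_order.
  by apply/eqP/andP => [/diagGL2_inj[-> ->] | [/eqP-> /eqP->]].
have xw : (x ^ w = y)%g by exact: diagGL2_swap.
have yw : (y ^ w = x)%g by exact: diagGL2_swap.
rewrite split_Cartan_classesE.
rewrite -(@card_involution_orbits _ _ _ (fun H : {group gT} => (H :^ w)%G)).
- rewrite (card_subgroups n_gt0 xyC genA eq_xy); congr (_ + _)%N.
  rewrite -(card_swap_fixed n_gt0 xyC genA eq_xy xw yw).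
  by apply: eq_card => H; rewrite !inE.
- move=> H; rewrite !inE => sHD; apply/subsetP => _ /imsetP[h hH ->].
  exact/swap_diagGL/(subsetP sHD).
- move=> H K; rewrite !inE => sHD sKD.
  exact: sameP (conj_class_eqP H K) (conjs_diagGL_in_diagGL sHD sKD).
Qed.

End SplitCartan.

Theorem corollary3p11 (l : nat) (l_prime : prime l) (l_odd : odd l) :
  (#|split_Cartan_classes l|%:R = (alpha (l - 1) + beta (l - 1))%:R / 2%:R :> rat)%R.
Proof.
by rewrite -card_classes_double // GRing.natrM GRing.mulrC GRing.mulKf.
Qed.
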